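(* If $\delta=1$ (that is, $r=\rho$), then $\bar F=F$ on $[0,\infty)$.
   Context: Constants: $r>0$, $\rho>0$, $\delta:=r/\rho$, $m>0$. ''Increasing'' and ''decreasing'' mean strictly so. The function $u:[0,\infty)\to[0,\infty)$ is increasing, strictly concave, twice continuously differentiable, $u(0)=0$, $\lim_{\pi\to\infty}u'(\pi)=0$, and $c_0(-1+\pi^{1/\gamma})\le u(\pi)\le c_1(1+\pi^{1/\gamma})$ for all $\pi\ge0$, for some $(c_0,c_1)\in(0,\infty)^2$ and some $\gamma>1$. Set $F(y):=-u^{-1}(y)$ for $y\ge0$. Face-lifted utility: let $\mathcal B_{\mathbb R_+}$ be the set of Borel-measurable maps from $\mathbb R_+$ to $\mathbb R_+$. For $y_0\ge0$ and $p\in\mathcal B_{\mathbb R_+}$ let $y^{y_0,p}$ solve $\dot y^{y_0,p}(t)=r(y^{y_0,p}(t)-p(t))$, $t>0$, $y^{y_0,p}(0)=y_0$, and let $T_0^{y_0,p}:=\inf\{t\ge0:y^{y_0,p}(t)\le0\}$. Then $$\bar F(y_0):=\sup_{p\in\mathcal B_{\mathbb R_+}}\ \sup_{T\in[0,T_0^{y_0,p}]}\Big\{\mathrm e^{-\rho T}F\big(y^{y_0,p}(T)\big)\mathbf 1_{\{T<\infty\}}+\int_0^T\rho\,\mathrm e^{-\rho t}\big(-m+F(p(t))\big)\mathrm dt\Big\}.$$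
   Formalization: T=∞ is allowed only when e^{-rt}y(t)→0 as t→∞; without this the claim fails: p=0, T=∞ gives the value −m, which exceeds F(y_0) as soon as y_0>u(m). *)

(* Defs.v *)
From HB Require Import structures.
From mathcomp Require Import all_boot all_order all_algebra.
From mathcomp Require Import all_classical all_reals all_analysis.
Set Implicit Arguments.
Unset Strict Implicit.
Unset Printing Implicit Defensive.
Import Order.TTheory GRing.Theory Num.Theory.
Import numFieldNormedType.Exports.
Local Open Scope classical_set_scope.
Local Open Scope ring_scope.

(* Functions on [0, oo) are represented by functions on R whose values on
   negative reals are never used. *)

(* f' is the derivative of f on [0, oo), one-sided at 0. *)
Definition is_derivative_on_nneg (R : realType) (f f' : R -> R) : Prop :=
  forall x : R, 0 <= x ->
    (f z - f x) / (z - x) @[z --> within [set z : R | 0 <= z] x^'] --> f' x.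

Definition strictly_concave_on_nneg (R : realType) (f : R -> R) : Prop :=
  forall x z t : R, 0 <= x -> 0 <= z -> x != z -> 0 < t -> t < 1 ->
    t * f x + (1 - t) * f z < f (t * x + (1 - t) * z).

(* u' and u'' are the first two derivatives of u. *)
Record is_utility (R : realType) (u u' u'' : R -> R) (c0 c1 gamma : R) : Prop :=
  IsUtility {
    utility_ge0 : forall x : R, 0 <= x -> 0 <= u x;
    utility_increasing : forall x z : R, 0 <= x -> x < z -> u x < u z;
    utility_concave : strictly_concave_on_nneg u;
    utility_deriv1 : is_derivative_on_nneg u u';
    utility_deriv2 : is_derivative_on_nneg u' u'';
    utility_C2 : {within [set x : R | 0 <= x], continuous u''};
    utility_at0 : u 0 = 0;
    utility_deriv_cvg0 : u' x @[x --> +oo] --> (0 : R);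
    utility_c0_gt0 : 0 < c0;
    utility_c1_gt0 : 0 < c1;
    utility_gamma_gt1 : 1 < gamma;
    utility_growth : forall x : R, 0 <= x ->
      c0 * (-1 + x `^ gamma^-1) <= u x <= c1 * (1 + x `^ gamma^-1) }.

(* [- u^-1], where u is inverted as a function on [0, oo). *)
Definition inv_cost (R : realType) (u : R -> R) (y : R) : R :=
  - 'pinv_(fun=> 0) [set x : R | 0 <= x] u y.

Definition Borel_nneg (R : realType) (p : R -> R) : Prop :=
  measurable_fun [set t : R | 0 <= t] p /\ forall t : R, 0 <= t -> 0 <= p t.

(* As p is only measurable, y' = r (y - p), y 0 = y0 is understood in the
   Caratheodory sense, i.e. through the integral equation. A solution on
   [0, oo) exists (and is then unique there) iff p is locally integrable. *)
Definition solves_state (R : realType) (r y0 : R) (p y : R -> R) : Prop :=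
  forall t : R, 0 <= t ->
    (@lebesgue_measure R).-integrable `[0, t]
      (fun s => (r * (y s - p s))%:E) /\
    y t = y0 + \int[@lebesgue_measure R]_(s in `[0, t]) (r * (y s - p s)).

(* Equal to +oo when y stays positive. *)
Definition hitting_time (R : realType) (y : R -> R) : \bar R :=
  ereal_inf [set t%:E | t in [set t : R | 0 <= t /\ y t <= 0]].

(* T ranges over [0, T_0] in the extended reals. For T = +oo the state must
   satisfy the transversality condition e^{-rt} y(t) --> 0, which amounts to
   y0 = \int_0^oo r e^{-rt} p(t) dt. Without it, p = 0 and T = +oo would be
   admissible for every y0 > 0 (then y(t) = y0 e^{rt} > 0) and would yield the
   value -m, so that the supremum could not be F(y0) as soon as F(y0) < -m. *)
Definition admissible_horizon (R : realType) (r : R) (y : R -> R)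
    (T : \bar R) : Prop :=
  [/\ (0 <= T)%E, (T <= hitting_time y)%E &
      T = +oo%E -> expR (- r * t) * y t @[t --> +oo] --> (0 : R)].

Definition terminal_payoff (R : realType) (rho : R) (F y : R -> R)
    (T : \bar R) : \bar R :=
  if T is t%:E then (expR (- rho * t) * F (y t))%:E else 0%E.

Definition payoff (R : realType) (rho m : R) (F p y : R -> R)
    (T : \bar R) : \bar R :=
  (terminal_payoff rho F y T +
   \int[@lebesgue_measure R]_(t in [set t : R | (0 <= t)%R /\ (t%:E <= T)%E])
      (rho * expR (- rho * t) * (- m + F (p t)))%:E)%E.

Definition facelift (R : realType) (r rho m : R) (F : R -> R) (y0 : R) :
    \bar R :=
  ereal_sup [set v : \bar R | exists (p y : R -> R) (T : \bar R),
    [/\ Borel_nneg p, solves_state r y0 p y, admissible_horizon r y T &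
        v = payoff rho m F p y T]].

(* Main.v *)
Require Import Defs.
From HB Require Import structures.
From mathcomp Require Import all_boot all_order all_algebra.
From mathcomp Require Import all_classical all_reals all_analysis.
From mathcomp Require Import measurable_realfun ring lra.
Import Order.TTheory GRing.Theory Num.Theory.
Import numFieldNormedType.Exports.
Local Open Scope classical_set_scope.
Local Open Scope ring_scope.

(** When [r = rho], the state equation turns the weights of the payoff into
    those of a probability measure.  Indeed, by the variation of constants
    formula ([solves_state_discounted]),
      e^{-rt} y(t) + \int_0^t r e^{-rs} p(s) ds = y0,
    while e^{-rt} + \int_0^t r e^{-rs} ds = 1: the initial state is an average
    of the terminal state and of the values of [p], with exactly the weights
    with which [F] is averaged in the payoff.  As [F] is concave, Jensen's
    inequality bounds the payoff by F(y0) minus the nonnegative cost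
    m (1 - e^{-rt}).  Equality is attained by stopping immediately
    ([facelift_ge]).

    Jensen's inequality is used through a supporting line of [F] at [y0],
    obtained from a tangent of the concave function [u]
    ([inv_cost_le_tangent]).  It bounds the running payoff on [0, t] by an
    explicit expression in e^{-rt} and e^{-rt} y(t) ([running_payoff_le]).  For
    a finite horizon, the supporting line is applied once more at y(t), which
    is nonnegative up to the hitting time of 0 ([payoff_finite_le]).  For the
    infinite horizon the running payoff, whose integrand is nonpositive, is at
    most its truncation to each [0, t], and the transversality condition gives
    the limit of the bound as t tends to +oo ([payoff_infinite_le]).

    As [p] is merely integrable, the variation of constants formula cannot be
    proved by differentiating; it follows instead from Fubini's theorem on the
    triangle v <= s ([Rintegral_Fubini_triangle]). *)

Set Implicit Arguments.
Unset Strict Implicit.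

Local Notation mu := (@lebesgue_measure _).

(** * Fubini's theorem on a triangle *)

(** Both sides are the double integral of g(s) h(v) over v <= s.  This plays
    the role of an integration by parts between the primitives of [g] and [h],
    for functions that are only integrable. *)
Lemma Rintegral_Fubini_triangle {R : realType} (g h : R -> R) :
  mu.-integrable setT (EFin \o g) ->
  mu.-integrable setT (EFin \o h) ->
  \int[mu]_s (g s * \int[mu]_(v in `]-oo, s]) h v) =
  \int[mu]_v (h v * \int[mu]_(s in `[v, +oo[) g s).
Proof.
move=> ig ih.
have mg : measurable_fun setT g.
  by apply/measurable_EFinP; exact: measurable_int ig.
have mh : measurable_fun setT h.
  by apply/measurable_EFinP; exact: measurable_int ih.
pose k (x : R * R) : R := if x.2 <= x.1 then g x.1 * h x.2 else 0.
have mgh : measurable_fun setT (fun x : R * R => g x.1 * h x.2).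
  by apply: measurable_funM; [exact: (measurableT_comp mg measurable_fst)
                             |exact: (measurableT_comp mh measurable_snd)].
have mk : measurable_fun setT (EFin \o k).
  apply/measurable_EFinP; apply: measurable_fun_ifT => //.
  by apply: measurable_fun_ler.
(* On the product space, k is dominated by |g(s)| |h(v)|. *)
have ik : (mu \x mu)%E.-integrable setT (EFin \o k).
  apply/integrable12ltyP => //=.
  pose Ih := (\int[mu]_v `|(h v)%:E|)%E.
  have Ih_lty : (Ih < +oo)%E by case/integrableP: ih.
  have Ih_ge0 : (0 <= Ih)%E by apply: integral_ge0 => v _; exact: abse_ge0.
  have Ihfin : Ih \is a fin_num by rewrite ge0_fin_numE.
  apply: (@le_lt_trans _ _ (\int[mu]_s (`|(g s)%:E| * Ih))%E).
    apply: ge0_le_integral => //.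
    - move=> s _; exact: integral_ge0.
    - refine (measurable_fun_fubini_tonelli_F (m2 := mu)
        (fun x : R * R => `|(k x)%:E|%E) _ _) => //.
      exact: measurableT_comp mk.
    - apply: emeasurable_funM => //; apply: measurableT_comp => //.
      exact/measurable_EFinP.
    - move=> s _; rewrite /Ih -ge0_integralZl//; last first.
        by apply: measurableT_comp => //; exact/measurable_EFinP.
      apply: ge0_le_integral => //.
      + have mks : measurable_fun setT (fun v : R => (k (s, v))%:E).
          exact: (measurableT_comp mk (measurable_pair1 _)).
        exact: (measurableT_comp (@abse_measurable R setT) mks).
      + by apply: emeasurable_funM => //; apply: measurableT_comp => //;
          exact/measurable_EFinP.
      + move=> v _; rewrite /k /=; case: ifP => _; first by rewrite normrM.
        by rewrite normr0 lee_fin mulr_ge0.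
  rewrite -(fineK Ihfin) ge0_integralZr//.
  - have Ig_ge0 : (0 <= \int[mu]_s `|(g s)%:E|)%E.
      by apply: integral_ge0.
    apply: lte_mul_pinfty => //; last exact: ltry.
    by rewrite ge0_fin_numE//; case/integrableP: ig.
  - by apply: measurableT_comp => //; exact/measurable_EFinP.
  - by rewrite lee_fin fine_ge0.
have := Fubini ik; rewrite /Rintegral => E.
congr fine; transitivity (\int[mu]_s
    \int[mu]_v (EFin \o k) (s, v))%E; last first.
  rewrite {}E; apply: eq_integral => v _ /=.
  rewrite EFinM fineK; last first.
    apply: integrable_fin_num => //; exact: integrableS ig.
  rewrite -integralZl//; last exact: integrableS ig.
  rewrite [RHS]integral_mkcond; apply: eq_integral => s _.
  rewrite patchE /k /=; case: ifPn => vs.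
    by rewrite ifT ?EFinM 1?muleC//; rewrite inE/= in_itv/= vs.
  by rewrite ifF//; apply/negbTE; apply: contra vs; rewrite inE/= in_itv/= andbT.
apply: eq_integral => s _ /=.
rewrite EFinM fineK; last first.
  apply: integrable_fin_num => //; exact: integrableS ih.
rewrite -integralZl//; last exact: integrableS ih.
rewrite [LHS]integral_mkcond; apply: eq_integral => v _.
rewrite patchE /k /=; case: (leP v s) => vs.
  by rewrite ifT ?EFinM//; rewrite inE/= in_itv/= vs.
rewrite ifF//; apply/negbTE; rewrite notin_setE/= in_itv/=.
by move=> /(lt_le_trans vs); rewrite ltxx.
Qed.

(** * Integrals against the discount density *)

Lemma integrable_discount {R : realType} (r : R) (D : set R) (f : R -> R) :
  0 <= r -> measurable D -> (forall s, D s -> 0 <= s) ->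
  mu.-integrable D (EFin \o f) ->
  mu.-integrable D (EFin \o (fun s => expR (- r * s) * f s)).
Proof.
move=> r0 mD D0 fi; have mf : measurable_fun D f.
  by apply/measurable_EFinP; exact: measurable_int fi.
apply: le_integrable fi => //.
  apply/measurable_EFinP; apply: measurable_funM => //.
  by apply: measurableT_comp => //; exact: measurable_funM.
move=> s /D0 s0 /=; rewrite lee_fin normrM ler_piMl// ger0_norm ?expR_ge0//.
by rewrite -expR0 ler_expR mulNr oppr_le0 mulr_ge0.
Qed.

Lemma continuous_discount {R : realType} (r : R) :
  continuous (fun s : R => expR (- r * s)).
Proof.
move=> s; apply: continuous_comp; last exact: continuous_expR.
by apply: cvgM; [exact: cvg_cst|exact: cvg_id].
Qed.

Lemma continuous_discount_density {R : realType} (r : R) :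
  continuous (fun s : R => r * expR (- r * s)).
Proof. by move=> s; apply: cvgM; [exact: cvg_cst|exact: continuous_discount]. Qed.

Lemma integrable_discount_density {R : realType} (r t : R) :
  mu.-integrable `[0, t] (EFin \o (fun s => r * expR (- r * s))).
Proof.
apply: continuous_compact_integrable; first exact: segment_compact.
exact/continuous_subspaceT/continuous_discount_density.
Qed.

Lemma integrable_discount_densityM {R : realType} (r t : R) (f : R -> R) :
  0 <= r -> mu.-integrable `[0, t] (EFin \o f) ->
  mu.-integrable `[0, t]
    (EFin \o (fun s => r * expR (- r * s) * f s)).
Proof.
move=> r0 fi.
have -> : EFin \o (fun s => r * expR (- r * s) * f s) =
    (fun s => r%:E * (EFin \o (fun s => expR (- r * s) * f s)%R) s)%E.
  by apply/funext => s /=; rewrite -EFinM mulrA.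
apply: integrableZl => //; apply: integrable_discount => // s /=.
by rewrite in_itv/= => /andP[].
Qed.

Lemma Rintegral_discount {R : realType} (r a b : R) : a <= b ->
  \int[mu]_(s in `[a, b]) (r * expR (- r * s)) =
  expR (- r * a) - expR (- r * b).
Proof.
rewrite le_eqVlt => /predU1P[->|ab]; first by rewrite set_itv1 Rintegral_set1 subrr.
rewrite /Rintegral (@continuous_FTC2 _ _ (fun s => - expR (- r * s))) //=.
- by rewrite opprK addrC.
- exact/continuous_subspaceT/continuous_discount_density.
- split.
  + by move=> z _; exact: ex_derive.
  + by apply/cvg_at_right_filter; apply: cvgN; exact: continuous_discount.
  + by apply/cvg_at_left_filter; apply: cvgN; exact: continuous_discount.
- move=> z _; rewrite derive1E.
  have [_ ->] : is_derive z 1 (fun s => - expR (- r * s)) (r * expR (- r * z)).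
    apply: is_derive_eq; rewrite /GRing.scale/=; ring.
  by [].
Qed.

(** Integration by parts of the discount factor against the primitive of an
    integrable [h], which need not be differentiable: swap the two integrals
    and use that the density has integral e^{-rv} - e^{-rt} over [v, t]. *)
Lemma Rintegral_discount_primitive {R : realType} (r t : R) (h : R -> R) :
  0 <= r -> 0 <= t ->
  mu.-integrable `[0, t] (EFin \o h) ->
  \int[mu]_(s in `[0, t])
    (r * expR (- r * s) * \int[mu]_(v in `[0, s]) h v) =
  \int[mu]_(s in `[0, t]) (expR (- r * s) * h s) -
  expR (- r * t) * \int[mu]_(s in `[0, t]) h s.
Proof.
move=> r0 t0 ih.
pose g (s : R) := r * expR (- r * s).
have ig : mu.-integrable `[0, t] (EFin \o g).
  exact: integrable_discount_density.
have iG : mu.-integrable setT (EFin \o (g \_ `[0, t])).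
  by rewrite -restrict_EFin; exact/(integrable_mkcond _ _).1.
have iH : mu.-integrable setT (EFin \o (h \_ `[0, t])).
  by rewrite -restrict_EFin; exact/(integrable_mkcond _ _).1.
have := Rintegral_Fubini_triangle iG iH.
have -> : (fun s => (g \_ `[0, t]) s *
     \int[mu]_(v in `]-oo, s]) (h \_ `[0, t]) v) =
   (fun s => g s * \int[mu]_(v in `[0, s]) h v) \_ `[0, t].
  apply/funext => s; rewrite !patchE; case: ifPn => [|_]; last by rewrite mul0r.
  rewrite inE/= in_itv/= => /andP[s0 st].
  rewrite -Rintegral_mkcondr; congr (_ * Rintegral _ _ _).
  apply/seteqP; split => v/=; rewrite !in_itv/=.
    by move=> [-> /andP[-> _]].
  by move=> /andP[-> vs]; rewrite vs (le_trans vs st).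
have -> : (fun v => (h \_ `[0, t]) v *
     \int[mu]_(s in `[v, +oo[) (g \_ `[0, t]) s) =
   (fun v => expR (- r * v) * h v - expR (- r * t) * h v) \_ `[0, t].
  apply/funext => v; rewrite !patchE; case: ifPn => [|_]; last by rewrite mul0r.
  rewrite inE/= in_itv/= => /andP[v0 vt].
  rewrite -Rintegral_mkcondr -mulrBl mulrC -Rintegral_discount//.
  congr (Rintegral _ _ _ * _).
  apply/seteqP; split => s/=; rewrite !in_itv/= ?andbT.
    by move=> [-> /andP[_ ->]].
  by move=> /andP[vs ->]; rewrite vs (le_trans v0 vs).
rewrite -!Rintegral_mkcond => ->.
rewrite RintegralB//; first by rewrite RintegralZl.
- by apply: integrable_discount => // s /=; rewrite in_itv/= => /andP[].
- exact: (integrableZl _ (expR (- r * t)) ih).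
Qed.

(** * The state equation *)

Lemma solves_state_continuous {R : realType} (r y0 : R) (p y : R -> R) (t : R) :
  0 <= t -> solves_state r y0 p y -> {within `[0, t], continuous y}.
Proof.
move=> t0 sol; have [ih _] := sol t t0.
pose Y x := y0 + \int[mu]_(s in `[0, x]) (r * (y s - p s)).
have YE : {in `[0, t]%classic, Y =1 y}.
  by move=> s; rewrite inE/= in_itv/= => /andP[s0 _]; rewrite (sol s s0).2.
apply: (subspace_eq_continuous YE) => s.
apply: (@continuousD _ _ _ (cst y0 : subspace `[0, t] -> R)).
  exact: cst_continuous.
exact: (parameterized_integral_continuous t0 ih).
Qed.

(** The integral equation only controls y - p; the control itself is integrable
    because [y] is bounded on a segment. *)
Lemma solves_state_control_integrable {R : realType} (r y0 : R) (p y : R -> R) (t : R) :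
  0 < r -> 0 <= t -> solves_state r y0 p y ->
  mu.-integrable `[0, t] (EFin \o p).
Proof.
move=> r0 t0 sol; have [ih _] := sol t t0.
have iy : mu.-integrable `[0, t] (EFin \o y).
  apply: continuous_compact_integrable; first exact: segment_compact.
  exact: solves_state_continuous sol.
have -> : EFin \o p = (EFin \o y \- (fun s => r^-1%:E * (r * (y s - p s))%:E))%E.
  apply/funext => s /=; congr EFin; rewrite mulKf ?gt_eqF//; ring.
apply: integrableB => //; exact: integrableZl.
Qed.

(** Variation of constants: discount the integral equation with the density
    r e^{-rs} and integrate by parts; the contributions of [y] to the two sides
    cancel. *)
Lemma solves_state_discounted {R : realType} (r y0 : R) (p y : R -> R) (t : R) :
  0 < r -> 0 <= t -> solves_state r y0 p y ->
  \int[mu]_(s in `[0, t]) (r * expR (- r * s) * p s) =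
  y0 - expR (- r * t) * y t.
Proof.
move=> r0 t0 sol; have [ih yE] := sol t t0.
have iy : mu.-integrable `[0, t] (EFin \o y).
  apply: continuous_compact_integrable; first exact: segment_compact.
  exact: solves_state_continuous sol.
have ip := solves_state_control_integrable r0 t0 sol.
have disc f := @integrable_discount_densityM _ r t f (ltW r0).
have ir := integrable_discount_density r t.
have := Rintegral_discount_primitive (ltW r0) t0 ih.
have -> : \int[mu]_(s in `[0, t]) (r * expR (- r * s) *
      \int[mu]_(v in `[0, s]) (r * (y v - p v))) =
    \int[mu]_(s in `[0, t]) (r * expR (- r * s) * y s) -
    y0 * (1 - expR (- r * t)).
  have <- : expR (- r * 0) = 1 by rewrite mulr0 expR0.
  rewrite -Rintegral_discount// -RintegralZl//.
  rewrite -RintegralB//; [|exact: disc|exact: (integrableZl _ y0 ir)].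
  apply: eq_Rintegral => s; rewrite inE/= in_itv/= => /andP[s0 _].
  rewrite (sol s s0).2; ring.
have -> : \int[mu]_(s in `[0, t])
      (expR (- r * s) * (r * (y s - p s))) =
    \int[mu]_(s in `[0, t]) (r * expR (- r * s) * y s) -
    \int[mu]_(s in `[0, t]) (r * expR (- r * s) * p s).
  rewrite -RintegralB//; [|exact: disc|exact: disc].
  by apply: eq_Rintegral => s _; ring.
by rewrite {}yE => E; lra.
Qed.

Lemma solves_state0 {R : realType} (r y0 : R) (p y : R -> R) :
  solves_state r y0 p y -> y 0 = y0.
Proof.
by move=> sol; rewrite (sol 0 (lexx 0)).2 set_itv1 Rintegral_set1 addr0.
Qed.

(** A continuous path that is negative at t has vanished strictly before t,
    hence has hit 0 strictly before t. *)
Lemma solves_state_ge0_before_hitting {R : realType} (r y0 : R)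
    (p y : R -> R) (t : R) :
  0 <= y0 -> 0 <= t -> solves_state r y0 p y -> (t%:E <= hitting_time y)%E ->
  0 <= y t.
Proof.
move=> y00 t0 sol t_hit; rewrite leNgt; apply/negP => yt0.
have [|c] := @IVT R y 0 t 0 t0 (solves_state_continuous t0 sol).
  by rewrite (solves_state0 sol) ge_min (ltW yt0) orbT le_max y00.
rewrite in_itv/= => /andP[c0 ct] yc.
have ct' : c < t.
  by rewrite lt_neqAle ct andbT; apply: contraTneq yt0 => <-; rewrite yc ltxx.
have : (hitting_time y <= c%:E)%E.
  by apply: ereal_inf_lbound; exists c => //=; rewrite yc.
by move=> /(le_trans t_hit); rewrite lee_fin leNgt ct'.
Qed.

(** * The inverse of the utility function *)

(** A concave function lies below its tangents: the slope from x to
    x + t (z - x) is at least the slope from x to z when z > x, and at most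
    when z < x, so multiplying by z - x gives the same inequality in both
    cases; then t tends to 0 from the right.  The point x may be the endpoint 0
    because only points between x and z are used. *)
Lemma concave_le_tangent {R : realType} (f f' : R -> R) (x z : R) :
  strictly_concave_on_nneg f -> is_derivative_on_nneg f f' ->
  0 <= x -> 0 <= z -> f z <= f x + f' x * (z - x).
Proof.
move=> fconc fder x0 z0; have [->|zx] := eqVneq z x.
  by rewrite subrr mulr0 addr0.
rewrite -lerBlDl.
pose w t : R := x + t * (z - x).
have pos : \forall t \near (0 : R)^'+, 0 < t by exact: nbhs_right_gt.
have lt1 : \forall t \near (0 : R)^'+, t < 1 by exact: nbhs_right_lt.
have wx : w t @[t --> 0^'+] --> within [set v : R | 0 <= v] x^'.
  have cw : w t @[t --> (0 : R)^'+] --> x.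
    apply: cvg_at_right_filter.
    rewrite [X in _ --> X](_ : x = w 0); last by rewrite /w mul0r addr0.
    by apply: cvgD; [exact: cvg_cst|apply: cvgM; [exact: cvg_id|exact: cvg_cst]].
  move=> A xA.
  have wA : \forall t \near (0 : R)^'+, w t != x -> 0 <= w t -> A (w t).
    exact: cw xA.
  apply: filterS3 wA pos lt1 => t wAt t0 t1; apply: wAt.
    by rewrite /w -subr_eq0 addrAC subrr add0r mulf_neq0 ?subr_eq0 ?(gt_eqF t0).
  have -> : w t = t * z + (1 - t) * x by rewrite /w; ring.
  by rewrite addr_ge0// mulr_ge0// ?subr_ge0 ltW.
have slope : (z - x) * ((f (w t) - f x) / (w t - x)) @[t --> 0^'+] -->
    (z - x) * f' x.
  by apply: cvgM; [exact: cvg_cst|exact: (cvg_comp _ _ wx (fder x x0))].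
rewrite mulrC; apply: (cvgr_to_ge slope); apply: filterS2 pos lt1 => t t0 t1.
have -> : w t - x = t * (z - x) by rewrite /w; ring.
have -> : (z - x) * ((f (w t) - f x) / (t * (z - x))) = (f (w t) - f x) / t.
  by field; rewrite gt_eqF//= subr_eq0.
rewrite ler_pdivlMr//.
have := fconc z x t z0 x0 zx t0 t1.
have -> : t * z + (1 - t) * x = w t by rewrite /w; ring.
by move=> H; lra.
Qed.

Lemma derivative_within_continuous {R : realType} (f f' : R -> R) (D : set R) :
  is_derivative_on_nneg f f' -> (forall x, D x -> 0 <= x) ->
  {within D, continuous f}.
Proof.
move=> fder D0; apply/subspace_continuousP => x Dx.
have x0 := D0 x Dx.
have cx : z - x @[z --> within [set v : R | 0 <= v] x^'] --> (0 : R).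
  have : z - x @[z --> x] --> x - x.
    by apply: cvgB; [exact: cvg_id|exact: cvg_cst].
  by rewrite subrr => ?; do 2 apply: cvg_within_filter.
have lim0 : (f z - f x) / (z - x) * (z - x)
    @[z --> within [set v : R | 0 <= v] x^'] --> f' x * 0.
  by apply: cvgM; [exact: fder|exact: cx].
rewrite mulr0 in lim0.
have /cvgrPdist_lt fx := lim0.
apply/cvgrPdist_lt => e e0; have := fx e e0.
rewrite !near_withinE; apply: filterS => z zP Dz.
have [->|zx] := eqVneq z x; first by rewrite subrr normr0.
rewrite distrC; have := zP zx (D0 z Dz).
by rewrite /= sub0r normrN divfK// subr_eq0.
Qed.

(** Unboundedness comes from the lower growth bound, the rest from the
    intermediate value theorem. *)
Lemma utility_surj {R : realType} (u u' u'' : R -> R) (c0 c1 gamma y : R) :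
  is_utility u u' u'' c0 c1 gamma -> 0 <= y -> exists2 x, 0 <= x & u x = y.
Proof.
move=> ut y0; have c0_gt0 := utility_c0_gt0 ut.
(* The lower growth bound c0 (-1 + b^(1/gamma)) is exactly y at this b. *)
pose b := (1 + y / c0) `^ gamma.
have b0 : 0 <= b by exact: powR_ge0.
have yb : y <= u b.
  have /andP[+ _] := utility_growth ut b0; apply: le_trans.
  have gamma0 : gamma != 0.
    by rewrite gt_eqF// (lt_trans ltr01)// (utility_gamma_gt1 ut).
  rewrite /b -powRrM mulfV// powRr1 ?addr_ge0 ?divr_ge0 ?(ltW c0_gt0)//.
  by rewrite addrA addNr add0r mulrC divfK ?gt_eqF.
have [||x x0b <-] := @IVT R u 0 b y b0.
- apply: derivative_within_continuous (utility_deriv1 ut) _ => x /=.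
  by rewrite in_itv/= => /andP[].
- by rewrite (utility_at0 ut) ge_min y0/= le_max yb orbT.
- by exists x => //; move: x0b; rewrite in_itv/= => /andP[].
Qed.

Lemma inv_costK {R : realType} (u u' u'' : R -> R) (c0 c1 gamma y : R) :
  is_utility u u' u'' c0 c1 gamma -> 0 <= y ->
  0 <= - inv_cost u y /\ u (- inv_cost u y) = y.
Proof.
move=> ut y0; rewrite /inv_cost opprK.
have usurj : set_surj [set x : R | 0 <= x] [set z : R | 0 <= z] u.
  by move=> z /= z0; have [x x0 <-] := utility_surj ut z0; exists x.
split; last by apply: (surjpK _ usurj); rewrite inE.
by apply: (surjpinv_image_sub (dflt := fun=> 0) usurj); exists y.
Qed.

Lemma inv_cost_le0 {R : realType} (u u' u'' : R -> R) (c0 c1 gamma y : R) :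
  is_utility u u' u'' c0 c1 gamma -> 0 <= y -> inv_cost u y <= 0.
Proof.
by move=> ut y0; rewrite -oppr_ge0; have [] := inv_costK ut y0.
Qed.

Lemma inv_cost_nonincreasing {R : realType} (u u' u'' : R -> R)
    (c0 c1 gamma y z : R) :
  is_utility u u' u'' c0 c1 gamma -> 0 <= y -> y <= z ->
  inv_cost u z <= inv_cost u y.
Proof.
move=> ut y0 yz; have z0 := le_trans y0 yz.
have [Gy0 uGy] := inv_costK ut y0.
have [Gz0 uGz] := inv_costK ut z0.
rewrite -lerN2 leNgt; apply/negP => /(utility_increasing ut Gz0).
by rewrite uGy uGz ltNge yz.
Qed.

(** The tangent of [u] at the preimage of [y], reflected: as its slope is
    positive, it can be solved for the preimage of [z].  At y = 0 this still
    provides a supporting line, from the one-sided derivative of [u]. *)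
Lemma inv_cost_le_tangent {R : realType} (u u' u'' : R -> R) (c0 c1 gamma y : R) :
  is_utility u u' u'' c0 c1 gamma -> 0 <= y ->
  exists k, forall z, 0 <= z -> inv_cost u z <= inv_cost u y + k * (z - y).
Proof.
move=> ut y0; have [x0 ux] := inv_costK ut y0.
set x := - inv_cost u y in x0 ux.
have tangent := concave_le_tangent (utility_concave ut) (utility_deriv1 ut) x0.
(* u (x + 1) lies strictly above u x and below the tangent at x. *)
have u'x_gt0 : 0 < u' x.
  have x1 : x < x + 1 by rewrite ltrDl.
  have := tangent _ (le_trans x0 (ltW x1)).
  have := utility_increasing ut x0 x1; lra.
exists (- (u' x)^-1) => z z0.
have [v0 uv] := inv_costK ut z0.
have := tangent _ v0; rewrite ux uv -lerBlDl -ler_pdivrMl// mulNr /x; lra.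
Qed.

Lemma measurable_inv_cost_comp {R : realType} (u u' u'' : R -> R)
    (c0 c1 gamma : R) (D : set R) (p : R -> R) :
  is_utility u u' u'' c0 c1 gamma -> measurable_fun D p ->
  (forall s, D s -> 0 <= p s) -> measurable_fun D (fun s => inv_cost u (p s)).
Proof.
move=> ut mp p0.
(* Monotonicity holds on [0, oo) only; freezing the negative arguments at 0
   extends it to the whole line. *)
pose G z := - inv_cost u (Num.max 0 z).
have mG : measurable_fun setT G.
  apply: nondecreasing_measurable => // y z yz; rewrite lerN2.
  apply: inv_cost_nonincreasing ut _ _; first by rewrite le_max lexx.
  by rewrite ge_max !le_max lexx/= yz orbT.
have mGp : measurable_fun D (fun s => - G (p s)).
  exact: measurableT_comp (measurableT_comp mG mp).
apply: eq_measurable_fun mGp => s; rewrite inE => /p0 ps0.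
by rewrite /G opprK max_r.
Qed.

(** * Bounds on the payoff *)

Lemma measurable_nneg {R : realType} : measurable [set s : R | 0 <= s].
Proof.
rewrite (_ : [set s | _] = `[0, +oo[%classic)//.
by apply/seteqP; split=> s /=; rewrite in_itv/= andbT.
Qed.

(** The integral of [f] may be -oo, which is what happens to the payoff of a
    control whose cost is not integrable. *)
Lemma le_integral_integrable_r d {T : measurableType d} {R : realType}
    (nu : {measure set T -> \bar R}) (D : set T) (f g : T -> \bar R) :
  measurable D -> measurable_fun D f ->
  nu.-integrable D g -> (forall x, D x -> (f x <= g x)%E) ->
  (\int[nu]_(x in D) f x <= \int[nu]_(x in D) g x)%E.
Proof.
move=> mD mf ig fg; have mg := measurable_int nu ig.
rewrite integralE [leRHS]integralE; apply: leeB; apply: ge0_le_integral => //.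
- exact: measurable_funepos.
- exact: measurable_funepos.
- by move=> x Dx; apply: (@funepos_le _ _ D); rewrite ?inE// => y /set_mem; exact: fg.
- exact: measurable_funeneg.
- exact: measurable_funeneg.
- by move=> x Dx; apply: (@funeneg_le _ _ D); rewrite ?inE// => y /set_mem; exact: fg.
Qed.

(** Integrate the supporting line of [F] at [y0] along [p], and evaluate the
    integral of [p] by variation of constants. *)
Lemma running_payoff_le {R : realType} (r m k y0 t : R) (F p y : R -> R) :
  0 < r -> 0 <= t ->
  (forall z, 0 <= z -> F z <= F y0 + k * (z - y0)) ->
  measurable_fun [set s : R | 0 <= s] (F \o p) ->
  (forall s, 0 <= s -> 0 <= p s) ->
  solves_state r y0 p y ->
  (\int[mu]_(s in `[0%R, t]) (r * expR (- r * s) * (- m + F (p s)))%:E <=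
   ((1 - expR (- r * t)) * (- m + F y0 - k * y0) +
    k * (y0 - expR (- r * t) * y t))%:E)%E.
Proof.
move=> r0 t0 tangent mFp p0 sol.
have seg0 : `[0, t] `<=` [set s : R | 0 <= s].
  by move=> s /=; rewrite in_itv/= => /andP[].
pose b := - m + F y0 - k * y0.
pose g s := b * (r * expR (- r * s)) + k * (r * expR (- r * s) * p s).
have iE := integrable_discount_density r t.
have iEp := integrable_discount_densityM (ltW r0)
  (solves_state_control_integrable r0 t0 sol).
have ib : mu.-integrable `[0, t] (EFin \o (fun s => b * (r * expR (- r * s)))).
  exact: (integrableZl _ b iE).
have ik : mu.-integrable `[0, t]
    (EFin \o (fun s => k * (r * expR (- r * s) * p s))).
  exact: (integrableZl _ k iEp).
have ig : mu.-integrable `[0, t] (EFin \o g) by exact: (integrableD _ ib ik).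
have <- : (\int[mu]_(s in `[0%R, t]) (g s)%:E)%E =
    ((1 - expR (- r * t)) * b + k * (y0 - expR (- r * t) * y t))%:E.
  rewrite -[LHS]fineK; last exact: integrable_fin_num.
  congr EFin; rewrite -/(Rintegral _ _ _) RintegralD//.
  rewrite [X in _ + X]RintegralZl// [X in X + _]RintegralZl//.
  rewrite Rintegral_discount// (solves_state_discounted r0 t0 sol).
  by rewrite mulr0 expR0 mulrC.
apply: le_integral_integrable_r => //.
  apply/measurable_EFinP; apply: measurable_funM.
    apply: measurable_funTS; apply: continuous_measurable_fun.
    exact: continuous_discount_density.
  apply: measurable_funD => //.
  exact: measurable_funS measurable_nneg seg0 mFp.
move=> s /seg0 s0; rewrite lee_fin.
have w0 := mulr_ge0 (ltW r0) (expR_ge0 (- r * s)).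
have := ler_wpM2l w0 (tangent _ (p0 s s0)).
by rewrite /g /b; lra.
Qed.

(** With the horizon T = 0 the payoff is F(y0) for every admissible control; the
    constant control [y0] makes the state stationary. *)
Lemma facelift_ge {R : realType} (r rho m : R) (F : R -> R) (y0 : R) :
  0 <= y0 -> ((F y0)%:E <= facelift r rho m F y0)%E.
Proof.
move=> y00; apply: ereal_sup_ubound.
exists (cst y0), (cst y0), 0%E; split.
- by split; [exact: measurable_cst|].
- move=> t t0; have -> : (fun s : R => (r * (cst y0 s - cst y0 s))%:E) = cst 0%E.
    by apply/funext => s; rewrite /= subrr mulr0.
  split; first exact: integrable0.
  under eq_Rintegral do rewrite subrr mulr0.
  by rewrite Rintegral_cst// mul0r addr0.
- split => //.
  by apply: le_ereal_inf_tmp => _ [t [t0 _] <-]; rewrite lee_fin.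
- rewrite /payoff /= mulr0 expR0 mul1r.
  rewrite (_ : [set t : R | _] = [set 0]); first by rewrite integral_set1 adde0.
  apply/seteqP; split => t /=; last by move=> ->; rewrite !lexx.
  by rewrite lee_fin => -[t0 t0']; apply/eqP; rewrite eq_le t0 t0'.
Qed.

(** The supporting line at y(t) contributes e^{-rt} (F(y0) + k (y(t) - y0)).
    Added to [running_payoff_le], all terms in [k] cancel, and what is left is
    F(y0) - m (1 - e^{-rt}). *)
Lemma payoff_finite_le {R : realType} (r m k y0 t : R) (F p y : R -> R) :
  0 < r -> 0 <= m -> 0 <= y0 -> 0 <= t ->
  (forall z, 0 <= z -> F z <= F y0 + k * (z - y0)) ->
  measurable_fun [set s : R | 0 <= s] (F \o p) ->
  (forall s, 0 <= s -> 0 <= p s) ->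
  solves_state r y0 p y -> (t%:E <= hitting_time y)%E ->
  (payoff r m F p y t%:E <= (F y0)%:E)%E.
Proof.
move=> r0 m0 y00 t0 tangent mFp p0 sol t_hit.
have yt0 := solves_state_ge0_before_hitting y00 t0 sol t_hit.
rewrite /payoff /=.
rewrite (_ : [set s : R | _] = `[0, t]%classic); last first.
  by apply/seteqP; split => s /=; rewrite in_itv/= lee_fin => /andP.
apply: (le_trans (leeD2l _ (running_payoff_le m r0 t0 tangent mFp p0 sol))).
rewrite -EFinD lee_fin.
have := ler_wpM2l (expR_ge0 (- r * t)) (tangent _ yt0).
have : expR (- r * t) <= 1.
  by rewrite -expR0 ler_expR mulNr oppr_le0 mulr_ge0// ltW.
by nra.
Qed.

(** Truncating the nonpositive integrand to [0, t] increases the integral, so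
    the bounds of [running_payoff_le] hold for all t; by transversality they
    converge to F(y0) - m. *)
Lemma payoff_infinite_le {R : realType} (r m k y0 : R) (F p y : R -> R) :
  0 < r -> 0 <= m ->
  (forall z, 0 <= z -> F z <= F y0 + k * (z - y0)) ->
  (forall z, 0 <= z -> F z <= 0) ->
  measurable_fun [set s : R | 0 <= s] (F \o p) ->
  (forall s, 0 <= s -> 0 <= p s) ->
  solves_state r y0 p y ->
  expR (- r * t) * y t @[t --> +oo] --> (0 : R) ->
  (payoff r m F p y +oo <= (F y0)%:E)%E.
Proof.
move=> r0 m0 tangent F_le0 mFp p0 sol transv.
rewrite /payoff /= add0e.
rewrite (_ : [set s : R | _] = [set s : R | 0 <= s]); last first.
  by apply/seteqP; split => s /= => [[]//|s0]; rewrite leey.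
set f := fun s : R => (_ * _ * (- m + F (p s)))%:E.
have seg0 t : `[0, t] `<=` [set s : R | 0 <= s].
  by move=> s /=; rewrite in_itv/= => /andP[].
have mnneg := @measurable_nneg R.
have mf : measurable_fun [set s : R | 0 <= s] f.
  apply/measurable_EFinP; apply: measurable_funM.
    apply: measurable_funTS; apply: continuous_measurable_fun.
    exact: continuous_discount_density.
  exact: measurable_funD.
have Nf_ge0 s : 0 <= s -> (0 <= - f s)%E.
  move=> s0; rewrite -EFinN lee_fin oppr_ge0.
  apply: mulr_ge0_le0; first by rewrite mulr_ge0 ?expR_ge0 ?ltW.
  by have := F_le0 _ (p0 s s0); lra.
have intN D : D `<=` [set s : R | 0 <= s] ->
    (\int[mu]_(s in D) f s = - \int[mu]_(s in D) - f s)%E.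
  move=> D0; rewrite -integral_ge0N; last by move=> s /D0; exact: Nf_ge0.
  by apply: eq_integral => s _; rewrite oppeK.
have trunc t : 0 <= t ->
    (\int[mu]_(s in [set s : R | (0 <= s)%R]) f s <=
     ((1 - expR (- r * t)) * (- m + F y0 - k * y0) +
      k * (y0 - expR (- r * t) * y t))%:E)%E.
  move=> t0; apply: le_trans (running_payoff_le m r0 t0 tangent mFp p0 sol).
  rewrite (intN _ (@subset_refl _ _)) [leRHS](intN _ (@seg0 t)) leeN2.
  apply: ge0_subset_integral => //.
  exact: measurableT_comp mf.
have disc0 : expR (- r * t) @[t --> +oo] --> (0 : R).
  rewrite (_ : (fun t => expR (- r * t)) =
               (fun z => expR (- z)) \o (fun z => r * z)); last first.
    by apply/funext => t /=; rewrite mulNr.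
  apply: (@cvg_comp _ _ _ _ _ _ (pinfty_nbhs R)); last exact: cvgr_expR.
  exact: gt0_cvgMry.
have bound : (1 - expR (- r * t)) * (- m + F y0 - k * y0) +
    k * (y0 - expR (- r * t) * y t)
    @[t --> +oo] --> (1 - 0) * (- m + F y0 - k * y0) + k * (y0 - 0).
  apply: cvgD; apply: cvgM; try exact: cvg_cst.
    by apply: cvgB => //; exact: cvg_cst.
  by apply: cvgB => //; exact: cvg_cst.
set I := (\int[_]_(s in _) _)%E in trunc *.
case: I trunc => [x|/(_ 0 (lexx 0))//|_]; last exact: leNye.
move=> trunc; rewrite lee_fin.
have : x <= (1 - 0) * (- m + F y0 - k * y0) + k * (y0 - 0).
  apply: (cvgr_to_ge bound); near=> t; rewrite -lee_fin; apply: trunc.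
  by near: t; exact: nbhs_pinfty_ge.
by lra.
Unshelve. all: by end_near. Qed.

Unset Implicit Arguments.
Set Strict Implicit.

Theorem proposition3p1 (R : realType) (r rho m : R)
    (u u' u'' : R -> R) (c0 c1 gamma : R)
    (r_gt0 : 0 < r) (rho_gt0 : 0 < rho) (m_gt0 : 0 < m)
    (u_utility : is_utility u u' u'' c0 c1 gamma)
    (delta_eq1 : r / rho = 1) :
  forall y0 : R, 0 <= y0 ->
    facelift r rho m (inv_cost u) y0 = (inv_cost u y0)%:E.
Proof.
move=> y0 y00; apply/eqP; rewrite eq_le facelift_ge// andbT.
have {delta_eq1} <- : r = rho.
  by rewrite -[r](divfK (lt0r_neq0 rho_gt0)) delta_eq1 mul1r.
apply: ge_ereal_sup => _ [p [y [T [[mp p0] sol [T0 T_hit transv] ->]]]].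
have [k tangent] := inv_cost_le_tangent u_utility y00.
have mFp := measurable_inv_cost_comp u_utility mp p0.
case: T T0 T_hit transv => [t|_ _ /(_ erefl) transv|//].
  rewrite lee_fin => t0 t_hit _.
  exact: payoff_finite_le (ltW m_gt0) y00 t0 tangent mFp p0 sol t_hit.
apply: payoff_infinite_le (ltW m_gt0) tangent _ mFp p0 sol transv => // z.
exact: inv_cost_le0 u_utility.
Qed.
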